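(* Let $Y$ be a topological vector space. If $Y$ is not locally convex, then the convex hull operation does not preserve H-lsc, i.e. there is a multifunction with values in $Y$ which is H-lsc at some point but whose convex hull is not H-lsc at that point. Indeed, if $Y$ is metrizable and not locally convex, then there exists a sequence $(y_n)_{n\ge 1}$ in $Y$ which converges to $0$ such that the convex hull of the set $\{y_n:n=1,2,\ldots\}$ is not bounded; and for such a sequence the multifunction $F:X\to 2^Y$, where $X=\{0\}\cup\{1/n:n=1,2,\ldots\}\subset\mathbb{R}$ with the subspace topology, defined by $F(0)=\{0,y_1,y_2,\ldots\}$ and $F(1/n)=\{0,y_1,\ldots,y_n\}$ for $n=1,2,\ldots$, is H-lsc at $0$, but the convex hull $\operatorname{conv}(F)$ of $F$ is not H-lsc at $0$.
   Context: $2^Y$ is the family of all subsets of $Y$; a multifunction from $X$ to $Y$ is a map $F:X\to 2^Y$. For a topological space $X$ and a topological vector space $Y$, a multifunction $F:X\to 2^Y$ is H-lsc (lower semicontinuous in the Hausdorff sense) at $x_0\in X$ if for every neighbourhood $V$ of $0$ in $Y$ there is a neighbourhood $U(x_0)$ of $x_0$ such that $F(x_0)\subset F(x)+V$ for every $x\in U(x_0)$, where $C+D=\{c+d:c\in C,\ d\in D\}$. The convex hull of a multifunction $F$ is the multifunction $\operatorname{conv}(F)$ given by $\operatorname{conv}(F)(x)=\operatorname{conv}(F(x))$ for $x\in X$, where $\operatorname{conv}(A)$ denotes the convex hull of $A\subset Y$. Bounded means bounded in the sense of topological vector spaces (absorbed by every neighbourhood of $0$). *)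

(* Defs.v *)
From HB Require Import structures.
From mathcomp Require Import all_boot all_order all_algebra.
From mathcomp Require Import all_classical all_reals all_analysis.

Set Implicit Arguments.
Unset Strict Implicit.
Unset Printing Implicit Defensive.

Import Order.TTheory GRing.Theory Num.Theory.
Import numFieldNormedType.Exports.

Local Open Scope classical_set_scope.
Local Open Scope ring_scope.

(* [tvsType] carries local convexity; a topological vector space that need not
   be locally convex (nor Hausdorff) is a [topologicalLmodType].  The condition
   below is the local convexity field of [tvsType]. *)
Definition is_locally_convex (R : realType) (Y : topologicalLmodType R) : Prop :=
  exists2 B : set_system Y, (forall b, b \in B -> convex_set b) & basis B.

Definition metrizable (R : realType) (Y : topologicalType) : Prop :=
  exists d : Y -> Y -> R,
    [/\ forall x z, d x z = 0 <-> x = z,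
        forall x z, d x z = d z x,
        forall x u z, d x z <= d x u + d u z &
        forall (x : Y) (U : set Y),
          nbhs x U <-> exists2 e : R, 0 < e & [set z | d x z < e] `<=` U].

Definition set_add (V : zmodType) (C D : set V) : set V :=
  [set c + d | c in C & d in D].

Definition convex_hull (R : realType) (Y : lmodType R) (A : set Y) : set Y :=
  smallest (@convex_set R Y) A.

Definition tvs_bounded (R : realType) (Y : topologicalLmodType R) (A : set Y) : Prop :=
  forall V : set Y, nbhs 0 V ->
    exists2 r : R, 0 < r & forall t : R, r <= `|t| -> A `<=` [set t *: v | v in V].

Definition Hlsc_at (R : realType) (X : topologicalType) (Y : topologicalLmodType R)
    (F : X -> set Y) (x0 : X) : Prop :=
  forall V : set Y, nbhs 0 V ->
    exists2 U : set X, nbhs x0 U & forall x, U x -> F x0 `<=` set_add (F x) V.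

Definition convex_hull_mf (R : realType) (X : Type) (Y : lmodType R) (F : X -> set Y) :
  X -> set Y := fun x => convex_hull (F x).

(* As a type, [inv_nat_set R] has the subspace topology (the initial topology of
   its inclusion in R). *)
Definition inv_nat_set (R : realType) : set R :=
  [set 0] `|` [set n%:R^-1 | n in [set n : nat | (0 < n)%N]].

Arguments inv_nat_set R : clear implicits.

Lemma inv_nat_set0 (R : realType) : 0 \in inv_nat_set R.
Proof. by apply: mem_set; left. Qed.

Lemma inv_nat_setV (R : realType) (n : nat) :
  (0 < n)%N -> n%:R^-1 \in inv_nat_set R.
Proof. by move=> n0; apply: mem_set; right; exists n. Qed.

Definition inv_nat0 (R : realType) : inv_nat_set R :=
  exist _ 0 (inv_nat_set0 R).

Arguments inv_nat0 R : clear implicits.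

Definition inv_natV (R : realType) (n : nat) (n0 : (0 < n)%N) : inv_nat_set R :=
  exist _ n%:R^-1 (inv_nat_setV R n0).

Arguments inv_natV R {n} n0.

(* Sequences are indexed from 1: the term [y 0] is never used. *)
Definition seq_range (Y : Type) (y : nat -> Y) : set Y :=
  [set y k | k in [set k : nat | (0 < k)%N]].

Definition seq_mf (R : realType) (Y : zmodType) (y : nat -> Y)
    (x : inv_nat_set R) : set Y :=
  [set z | (set_val x = 0 /\ (z = 0 \/ seq_range y z)) \/
           exists n : nat, [/\ (0 < n)%N, set_val x = n%:R^-1 &
             z = 0 \/ exists2 k : nat, (0 < k <= n)%N & z = y k]].

Lemma seq_mf0 (R : realType) (Y : zmodType) (y : nat -> Y) :
  seq_mf y (inv_nat0 R) = [set 0] `|` seq_range y.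
Proof.
apply/seteqP; split => z /=.
  case=> [[_ []]|[n [n0 /esym/eqP]]]; [by left|by right|].
  by rewrite invr_eq0 pnatr_eq0 -leqn0 leqNgt n0.
by case=> [->|zy]; left; split => //; [left|right].
Qed.

Lemma seq_mfV (R : realType) (Y : zmodType) (y : nat -> Y) (n : nat)
    (n0 : (0 < n)%N) :
  seq_mf y (inv_natV R n0) =
    [set 0] `|` [set y k | k in [set k : nat | (0 < k <= n)%N]].
Proof.
apply/seteqP; split => z /=.
  case=> [[/eqP]|[m [m0 /invr_inj/eqP]]].
    by rewrite invr_eq0 pnatr_eq0 -leqn0 leqNgt n0.
  rewrite eqr_nat => /eqP <- [->|[k kn ->]]; first by left.
  by right; exists k.
by case=> [->|[k kn <-]]; right; exists n; split => //; [left|right; exists k].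
Qed.

(* Main.v *)
(* Failure of H-lsc for some convex hull means: there are a set [A] and a
   neighbourhood [V] of 0 such that for every neighbourhood [U] of 0 some [B]
   satisfies [A <= B + U] but not [conv A <= conv B + V].  Let [W 0] contain the
   convex hull of no neighbourhood of 0, and let [W n] be balanced
   neighbourhoods with [W n.+1 + W n.+1 <= W n]; they define a coarser
   pseudometrizable vector topology.
   - If the closure of every neighbourhood [U] of 0 in the coarser topology is a
     neighbourhood of 0 for it, let [A] be a sequence null in the coarser
     topology whose hull is not absorbed by [W 0].  Up to errors in [U], all but
     finitely many of its terms can be made so small that the hull becomes
     bounded with respect to [W 0].
   - Otherwise there are [b i] in [W i.+3] and a neighbourhood [V] of 0 such that
     [\sum_i s i *: b i] lies in [V] only if all the [s i] are at most 1 in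
     absolute value.  Let [A] consist of the [i.+1 *: b i].  Given [U], choose a
     convex combination of points [u k] of [U] outside [W 0], and add [u k] to
     the [k]-th term of [A] after a large rank [N].  The same convex combination
     of these terms of [A] is then far from the new hull: by rigidity the
     coefficients of an approximation would be almost the same, and the
     combination of the [u k] would lie in [W 0].
   In the metrizable case, the balls of radius [n.+1^-1] give an unbounded hull
   of a null sequence, and the first argument, with no errors, applies to
   [seq_mf]. *)
Require Import Defs.
From HB Require Import structures.
From mathcomp Require Import all_boot all_order all_algebra.
From mathcomp Require Import all_classical all_reals all_analysis.
From mathcomp Require Import ring lra.

Set Implicit Arguments.
Unset Strict Implicit.
Unset Printing Implicit Defensive.

Import Order.TTheory GRing.Theory Num.Theory.
Import numFieldNormedType.Exports.

Local Open Scope classical_set_scope.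
Local Open Scope ring_scope.

(** * Balanced neighbourhoods of 0 and strings of them *)

Definition balanced (R : realType) (Y : lmodType R) (V : set Y) : Prop :=
  forall (t : R) (x : Y), `|t| <= 1 -> V x -> V (t *: x).

Lemma balancedN (R : realType) (Y : lmodType R) (V : set Y) (x : Y) :
  balanced V -> V x -> V (- x).
Proof. by move=> bV Vx; rewrite -scaleN1r; apply: bV => //; rewrite normrN1. Qed.

Lemma nbhs0_addP (R : realType) (Y : topologicalLmodType R) (V : set Y) :
  nbhs 0 V ->
  exists2 U : set Y, nbhs 0 U & forall x y, U x -> U y -> V (x + y).
Proof.
move=> V0; have := @add_continuous Y (0, 0) V.
rewrite /= addr0 => /(_ V0)[]/= [B1 B2] /= [nB1 nB2] BV.
exists (B1 `&` B2); first exact: filterI.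
by move=> x y [x1 _] [_ y2]; exact: (BV (x, y)).
Qed.

Lemma nbhs_scale_preimage (R : realType) (Y : topologicalLmodType R)
    (V : set Y) (r : R) (x : Y) :
  nbhs (r *: x) V -> nbhs x [set z | V (r *: z)].
Proof.
move=> V0; have := @scale_continuous R Y (r, x) V.
rewrite /= => /(_ V0)[]/= [B1 B2] /= [nB1 nB2] BV.
apply: filterS nB2 => z B2z; apply: (BV (r, z)); split => //=.
exact: nbhs_singleton nB1.
Qed.

Lemma nbhs_add_preimage (R : realType) (Y : topologicalLmodType R)
    (V : set Y) (c x : Y) :
  nbhs (c + x) V -> nbhs x [set z | V (c + z)].
Proof.
move=> V0; have := @add_continuous Y (c, x) V.
rewrite /= => /(_ V0)[]/= [B1 B2] /= [nB1 nB2] BV.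
apply: filterS nB2 => z B2z; apply: (BV (c, z)); split => //=.
exact: nbhs_singleton nB1.
Qed.

Lemma nbhs0_scale_bounds (R : realType) (Y : topologicalLmodType R)
    (V : set Y) (x : Y) :
  nbhs 0 V -> exists2 e : R, 0 < e &
    exists2 U : set Y, nbhs x U &
      forall (t : R) z, `|t| <= e -> U z -> V (t *: z).
Proof.
move=> V0; have := @scale_continuous R Y (0, x) V.
rewrite /= scale0r => /(_ V0)[]/= [B1 B2] /= [nB1 nB2] BV.
have [e e0 eB] : exists2 e : R, 0 < e & ball (0 : R) e `<=` B1.
  by case/nbhs_ballP: nB1 => e /= e0 eB; exists e.
exists (e / 2); first by rewrite divr_gt0.
exists B2 => // t z te B2z; apply: (BV (t, z)); split => //=.
apply: eB; rewrite /ball/= sub0r normrN (le_lt_trans te)//.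
by rewrite ltr_pdivrMr// ltr_pMr// ltr1n.
Qed.

Lemma nbhs0_absorbs (R : realType) (Y : topologicalLmodType R)
    (V : set Y) (x : Y) :
  nbhs 0 V -> exists2 e : R, 0 < e & forall t : R, `|t| <= e -> V (t *: x).
Proof.
move=> /(@nbhs0_scale_bounds R Y V x)[e e0 [U Ux UV]]; exists e => // t te.
by apply: UV => //; exact: nbhs_singleton Ux.
Qed.

Lemma nbhs0_balanced (R : realType) (Y : topologicalLmodType R) (V : set Y) :
  nbhs 0 V ->
  exists U : set Y, [/\ nbhs 0 U, balanced U & U `<=` V].
Proof.
move=> /(@nbhs0_scale_bounds R Y V 0)[e e0 [U U0 UV]].
(* The balanced core of [V]; it contains [e *: U], which makes it a neighbourhood of 0. *)
exists [set x | forall t : R, `|t| <= 1 -> V (t *: x)]; split.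
- have : nbhs (0 : Y) [set z | U (e^-1 *: z)].
    by apply: nbhs_scale_preimage; rewrite scaler0.
  apply: filterS => x /= Ux t t1.
  have -> : t *: x = (t * e) *: (e^-1 *: x).
    by rewrite scalerA mulfK ?lt0r_neq0.
  by apply: UV => //; rewrite normrM (gtr0_norm e0) ler_piMl// ltW.
- by move=> t x t1 Vx s s1; rewrite scalerA; apply: Vx; rewrite normrM mulr_ile1.
- by move=> x /(_ 1); rewrite scale1r normr1 => /(_ (lexx _)).
Qed.

Lemma nbhs0_halve (R : realType) (Y : topologicalLmodType R) (V : set Y) :
  nbhs 0 V ->
  exists U : set Y,
    [/\ nbhs 0 U, balanced U & forall x y, U x -> U y -> V (x + y)].
Proof.
move=> /nbhs0_addP[U1 /nbhs0_balanced[U [U0 bU sU]] UV].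
by exists U; split => // x y /sU Ux /sU Uy; exact: UV.
Qed.

Definition nbhs_string (R : realType) (Y : topologicalLmodType R)
    (W : nat -> set Y) : Prop :=
  [/\ forall n, nbhs 0 (W n), forall n, balanced (W n) &
      forall n x y, W n.+1 x -> W n.+1 y -> W n (x + y)].

Lemma nbhs_string_exists (R : realType) (Y : topologicalLmodType R) (V : set Y) :
  nbhs 0 V -> exists2 W : nat -> set Y, nbhs_string W & W 0%N `<=` V.
Proof.
move=> V0.
have /choice[h hP] : forall U : set Y, exists U' : set Y, nbhs 0 U ->
    [/\ nbhs 0 U', balanced U' & forall x y, U' x -> U' y -> U (x + y)].
  move=> U; case: (pselect (nbhs 0 U)) => [/nbhs0_halve[U' ?]|?].
    by exists U'.
  by exists U.
have hN n : nbhs 0 (iter n h V).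
  by elim: n => [//|n IH]; rewrite iterS; have [] := hP _ IH.
(* The iteration starts at [n.+1] because [V] itself need not be balanced. *)
exists (fun n => iter n.+1 h V).
  split => n; first exact: hN.
    by have [] := hP _ (hN n).
  by have [] := hP _ (hN n.+1).
move=> x /= Vx; have [hV _ hadd] := hP _ V0.
by rewrite -[x]addr0; apply: hadd => //; exact: nbhs_singleton hV.
Qed.

Lemma nbhs_string0 (R : realType) (Y : topologicalLmodType R)
    (W : nat -> set Y) n : nbhs_string W -> W n 0.
Proof. by case=> W0 _ _; exact: nbhs_singleton (W0 n). Qed.

Lemma nbhs_string_le (R : realType) (Y : topologicalLmodType R)
    (W : nat -> set Y) (m n : nat) :
  nbhs_string W -> (m <= n)%N -> W n `<=` W m.
Proof.
move=> sW /subnK <-; elim: (n - m)%N => [//|k IH] x; rewrite addSn => Wx.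
apply: IH; have [_ _ Wadd] := sW.
by rewrite -[x]addr0; apply: Wadd => //; exact: nbhs_string0.
Qed.

(** The first term and, by induction, the sum of the others both lie in [W q.+1]. The number of
    terms is irrelevant, so tails of any length stay small. *)
Lemma nbhs_string_sum (R : realType) (Y : topologicalLmodType R)
    (W : nat -> set Y) (n q : nat) (w : nat -> Y) :
  nbhs_string W -> (forall i, (i < n)%N -> W (q + i).+1 (w i)) ->
  W q (\sum_(i < n) w i).
Proof.
move=> sW; elim: n q w => [|n IH] q w wW.
  by rewrite big_ord0; exact: nbhs_string0.
have [_ _ Wadd] := sW.
rewrite big_ord_recl; apply: Wadd.
  by have := wW 0%N isT; rewrite addn0.
apply: (IH q.+1 (fun i => w i.+1)) => i ilt.
by rewrite addSnnS; exact: wW.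
Qed.

(** * Convex hulls and the failure of local convexity *)

Lemma convex_setP (R : realType) (Y : lmodType R) (C : set Y) :
  @convex_set R Y C <->
  forall (x y : Y) (t : R), 0 <= t -> t <= 1 -> C x -> C y ->
    C (t *: x + (1 - t) *: y).
Proof.
split=> [cC x y t t0 t1 Cx Cy|cC x y t /set_mem Cx /set_mem Cy].
  by have /set_mem := cC x y (Itv01 t0 t1) (mem_set Cx) (mem_set Cy).
by apply/mem_set; apply: cC.
Qed.

Lemma convex_hull_convex (R : realType) (Y : lmodType R) (A : set Y) :
  @convex_set R Y (convex_hull A).
Proof.
apply/convex_setP => x y t t0 t1 hx hy C [/= cC AC].
by move/convex_setP: (cC); apply => //; [exact: hx|exact: hy].
Qed.

Lemma convex_set_sum (R : realType) (Y : lmodType R) (C : set Y) (n : nat)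
    (t : nat -> R) (y : nat -> Y) :
  @convex_set R Y C -> (forall i, (i < n)%N -> 0 <= t i) ->
  (forall i, (i < n)%N -> C (y i)) ->
  \sum_(i < n) t i = 1 -> C (\sum_(i < n) t i *: y i).
Proof.
move=> /convex_setP cC t0 Cy t1.
(* Partial sums are renormalised by their weight, so that each new term is one binary convex
   combination; a zero weight so far is treated apart. *)
suff H m : (m <= n)%N -> 0 < \sum_(i < m) t i ->
    C ((\sum_(i < m) t i)^-1 *: \sum_(i < m) t i *: y i).
  by have := H n (leqnn n); rewrite t1 invr1 scale1r; exact.
elim: m => [|m IH] mn; first by rewrite big_ord0 ltxx.
rewrite !big_ord_recr /=.
set T := \sum_(i < m) t i; set S := \sum_(i < m) _.
have T0 : 0 <= T by apply: sumr_ge0 => i _; apply: t0; exact: (ltn_trans (ltn_ord i)).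
have tm0 := t0 _ mn.
move: T0; rewrite le_eqVlt => /orP[/eqP T0|T0] Tm.
  have S0 : S = 0.
    rewrite /S big1// => i _.
    have /eqP : t i = 0.
      apply/eqP; move: T0 => /esym/eqP; rewrite psumr_eq0.
        by move=> /allP/(_ i); rewrite mem_index_enum => /(_ isT).
      by move=> j _; apply: t0; exact: (ltn_trans (ltn_ord j)).
    by move=> /eqP ->; rewrite scale0r.
  move: Tm; rewrite -T0 S0 !add0r => tm.
  by rewrite scalerA mulVf ?lt0r_neq0// scale1r; exact: Cy.
have -> : (T + t m)^-1 *: (S + t m *: y m) =
    (T / (T + t m)) *: (T^-1 *: S) + (1 - T / (T + t m)) *: y m.
  rewrite scalerDr !scalerA; congr (_ *: _ + _ *: _).
    by field; rewrite !lt0r_neq0.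
  by field; rewrite !lt0r_neq0.
apply: cC.
- by rewrite divr_ge0 ?ltW.
- by rewrite ler_pdivrMr// mul1r lerDl.
- by apply: IH => //; exact: ltnW.
- exact: Cy.
Qed.

Lemma sum_scale_widen (R : realType) (Y : lmodType R) (m n : nat)
    (s : nat -> R) (y : nat -> Y) :
  (m <= n)%N -> (forall i, (m <= i)%N -> s i = 0) ->
  \sum_(i < n) s i *: y i = \sum_(i < m) s i *: y i.
Proof.
move=> mn s0; rewrite -!(big_mkord xpredT (fun i => s i *: y i)).
rewrite (@big_cat_nat _ _ _ m)//= -[RHS]addr0; congr (_ + _).
by rewrite big_nat big1// => i /andP[mi _]; rewrite s0// scale0r.
Qed.

Lemma sum_widen (R : realType) (m n : nat) (s : nat -> R) :
  (m <= n)%N -> (forall i, (m <= i)%N -> s i = 0) ->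
  \sum_(i < n) s i = \sum_(i < m) s i.
Proof.
move=> mn s0; have := @sum_scale_widen R R^o m n s (fun=> 1) mn s0.
by under eq_bigr do rewrite /GRing.scale/= mulr1;
  under [in RHS]eq_bigr do rewrite /GRing.scale/= mulr1.
Qed.

(** Coefficients are indexed by the sequence itself and extended by 0, so that two combinations can
    be compared coefficient by coefficient. *)
Lemma convex_hull_range (R : realType) (Y : lmodType R) (y : nat -> Y) (x : Y) :
  convex_hull (range y) x ->
  exists n (s : nat -> R), [/\ forall i, 0 <= s i,
    forall i, (n <= i)%N -> s i = 0, \sum_(i < n) s i = 1 &
    x = \sum_(i < n) s i *: y i].
Proof.
apply: (smallest_sub
  (X := [set x | exists n (s : nat -> R), [/\ forall i, 0 <= s i,
    forall i, (n <= i)%N -> s i = 0, \sum_(i < n) s i = 1 &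
    x = \sum_(i < n) s i *: y i]])).
  apply/convex_setP => a b t t0 t1 [n [s [s0 sn s1 ->]]] [m [r [r0 rm r1 ->]]].
  exists (maxn n m), (fun i => t * s i + (1 - t) * r i); split.
  - by move=> i; rewrite addr_ge0// mulr_ge0// subr_ge0.
  - by move=> i; rewrite geq_max => /andP[ni mi]; rewrite sn// rm// !mulr0 addr0.
  - rewrite big_split/= -!mulr_sumr (sum_widen (leq_maxl _ _) sn).
    by rewrite (sum_widen (leq_maxr _ _) rm) s1 r1 !mulr1 subrKC.
  - under [RHS]eq_bigr do rewrite scalerDl -!scalerA.
    rewrite big_split/= -!scaler_sumr.
    rewrite (sum_scale_widen _ (leq_maxl _ _) sn).
    by rewrite (sum_scale_widen _ (leq_maxr _ _) rm).
move=> _ [k _ <-]; exists k.+1, (fun i => (i == k)%:R); split.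
- by move=> i; rewrite ler0n.
- by move=> i ki; rewrite gtn_eqF.
- rewrite big_ord_recr/= eqxx big1 ?add0r// => i _.
  by rewrite ltn_eqF.
- rewrite big_ord_recr/= eqxx scale1r big1 ?add0r// => i _.
  by rewrite ltn_eqF// scale0r.
Qed.

Lemma convex_hull_sum (R : realType) (Y : lmodType R) (A : set Y) (x : Y) :
  convex_hull A x ->
  exists n (t : nat -> R) (y : nat -> Y), [/\ forall i, 0 <= t i,
    forall i, (i < n)%N -> A (y i), \sum_(i < n) t i = 1 &
    x = \sum_(i < n) t i *: y i].
Proof.
(* With lists of weighted points, mixing two combinations is a concatenation. *)
have H : convex_hull A `<=` [set x | exists l : seq (R * Y),
    [/\ forall p, p \in l -> 0 <= p.1 /\ A p.2, \sum_(p <- l) p.1 = 1 &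
    x = \sum_(p <- l) p.1 *: p.2]].
  apply: smallest_sub.
    apply/convex_setP => a b t t0 t1 [l [l0 l1 ->]] [r [r0 r1 ->]].
    exists ([seq (t * p.1, p.2) | p <- l] ++ [seq ((1 - t) * p.1, p.2) | p <- r]).
    split.
    - move=> p; rewrite mem_cat => /orP[] /mapP[q /= ql ->] /=.
        by have [q0 Aq] := l0 _ ql; split => //; exact: mulr_ge0.
      have [q0 Aq] := r0 _ ql; split => //.
      by rewrite mulr_ge0// subr_ge0.
    - by rewrite big_cat/= !big_map/= -!mulr_sumr l1 r1 !mulr1 subrKC.
    - rewrite big_cat/= !big_map/= !scaler_sumr.
      by congr (_ + _); apply: eq_bigr => p _; rewrite scalerA.
  move=> z Az; exists [:: (1, z)]; split.
  - by move=> p; rewrite inE => /eqP -> /=; split => //; exact: ler01.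
  - by rewrite big_seq1.
  - by rewrite big_seq1 scale1r.
move=> /H[l [l0 l1 ->]]; exists (size l), (fun i => (nth (0, 0) l i).1),
  (fun i => (nth (0, 0) l i).2); split.
- move=> i; have [il|il] := ltnP i (size l); last by rewrite nth_default.
  by have [] := l0 _ (mem_nth (0, 0) il).
- by move=> i il; have [] := l0 _ (mem_nth (0, 0) il).
- by rewrite -l1 (big_nth (0, 0)) big_mkord.
- by rewrite (big_nth (0, 0)) big_mkord.
Qed.

(** By contraposition: if every neighbourhood of 0 contains the hull of another one, the interiors
    of the translated hulls are convex, and the open convex sets form a basis. *)
Lemma not_locally_convex_hull (R : realType) (Y : topologicalLmodType R) :
  ~ is_locally_convex Y ->
  exists2 W : set Y, nbhs 0 W & forall V, nbhs 0 V -> ~ convex_hull V `<=` W.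
Proof.
move=> nlc; apply: contra_notP nlc => H.
have {}H (W : set Y) : nbhs 0 W -> exists2 V, nbhs 0 V & convex_hull V `<=` W.
  move=> W0; apply: contra_notP H => H; exists W => // V V0 VW.
  by apply: H; exists V.
exists [set C : set Y | open C /\ @convex_set R Y C].
  by move=> C /set_mem[].
split=> [C []//|x U /= xU].
have [V V0 VU] : exists2 V, nbhs 0 V & convex_hull V `<=` [set z | U (x + z)].
  by apply: H; apply: nbhs_add_preimage; rewrite addr0.
pose C := [set z | convex_hull V (- x + z)].
have cC : @convex_set R Y C.
  apply/convex_setP => y z t t0 t1 Cy Cz; rewrite /C/=.
  have -> : - x + (t *: y + (1 - t) *: z) = t *: (- x + y) + (1 - t) *: (- x + z).
    by rewrite !scalerDr addrACA -scalerDl subrKC scale1r.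
  by move/convex_setP: (@convex_hull_convex R Y V); apply.
have CU : C `<=` U by move=> z /VU /=; rewrite addrA subrr add0r.
have Cx : nbhs x C.
  apply: nbhs_add_preimage; rewrite addNr.
  by apply: filterS V0; exact: sub_gen_smallest.
exists (interior C); last first.
  by move=> z /interior_subset; exact: CU.
split=> //; split; first exact: open_interior.
apply/convex_setP => y z t t0 t1 Cy Cz.
have := t0; rewrite le_eqVlt => /orP[/eqP <-|{}t0].
  by rewrite scale0r add0r subr0 scale1r.
(* the preimage of [C] under [w |-> t^-1 *: (w - (1 - t) *: z)] is a
   neighbourhood of the convex combination, and convexity puts it in [C] *)
have ty : nbhs (- ((1 - t) *: z) + (t *: y + (1 - t) *: z)) [set w | C (t^-1 *: w)].
  rewrite addrC addrK; apply: nbhs_scale_preimage.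
  by rewrite scalerA mulVf ?lt0r_neq0// scale1r.
have := nbhs_add_preimage ty; apply: filterS => w /= Cw.
have -> : w = t *: (t^-1 *: (- ((1 - t) *: z) + w)) + (1 - t) *: z.
  by rewrite scalerA divff ?lt0r_neq0// scale1r addrC addrA subrr add0r.
by move/convex_setP: cC; apply=> //; [exact: ltW|exact: interior_subset].
Qed.

(** * Finite combinations and total boundedness of parallelepipeds *)

Lemma small_combination (R : realType) (Y : topologicalLmodType R)
    (V : set Y) (m : nat) (u : nat -> Y) :
  nbhs 0 V ->
  exists2 e : R, 0 < e & forall s : nat -> R,
    (forall i, (i < m)%N -> `|s i| <= e) -> V (\sum_(i < m) s i *: u i).
Proof.
elim: m V => [|m IH] V V0.
  by exists 1 => // s _; rewrite big_ord0; exact: nbhs_singleton.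
have [U [U0 _ UV]] := nbhs0_halve V0.
have [e1 e10 e1U] := IH _ U0.
have [e2 e20 e2U] := nbhs0_absorbs (u m) U0.
exists (Num.min e1 e2); first by rewrite lt_min e10.
move=> s se; rewrite big_ord_recr/=; apply: UV.
  by apply: e1U => i im; have := se _ (ltnW im); rewrite le_min => /andP[].
by apply: e2U; have := se m (ltnSn m); rewrite le_min => /andP[].
Qed.

Lemma finite_net (R : realType) (Y : topologicalLmodType R)
    (V : set Y) (m : nat) (u : nat -> Y) :
  nbhs 0 V ->
  exists l : seq Y, forall s : nat -> R,
    (forall i, (i < m)%N -> `|s i| <= 1) ->
    exists2 c, c \in l & V (\sum_(i < m) s i *: u i - c).
Proof.
elim: m V => [|m IH] V V0.
  exists [:: 0] => s _; exists 0; first by rewrite inE.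
  by rewrite big_ord0 subrr; exact: nbhs_singleton.
have [U [U0 _ UV]] := nbhs0_halve V0.
have [l lP] := IH _ U0.
have [e e0 eU] := nbhs0_absorbs (u m) U0.
pose N := (Num.truncn e^-1).+1.
have N0 : 0 < N%:R :> R by rewrite ltr0n.
have Ne : N%:R^-1 <= e.
  rewrite -[e]invrK lef_pV2 ?posrE ?invr_gt0//.
  by rewrite ltW// truncnS_gt.
(* The last coefficient is rounded down to the grid of mesh [N^-1] in [-1, 1], whose points are
   given by k = 0, ..., 2N. *)
pose g k : Y := (k%:R / N%:R - 1 : R) *: u m.
exists [seq c + g k | c <- l, k <- iota 0 (2 * N).+1] => s s1.
have [|c cl Uc] := lP s; first by move=> i im; apply: s1; exact: ltnW.
have := s1 _ (ltnSn m); rewrite ler_norml => /andP[sm1 sm2].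
pose k := Num.truncn ((s m + 1) * N%:R).
have sN0 : 0 <= (s m + 1) * N%:R by rewrite mulr_ge0 ?ler0n//; lra.
have /andP[k1 k2] := truncn_itv sN0.
exists (c + g k).
  apply: allpairs_f => //; rewrite mem_iota/= add0n ltnS -(ler_nat R).
  rewrite (le_trans k1)// natrM ler_wpM2r ?ler0n//; lra.
rewrite big_ord_recr/= opprD addrACA; apply: UV => //.
rewrite /g -scalerBl; apply: eU; apply: le_trans Ne.
have -> : s m - (k%:R / N%:R - 1) = ((s m + 1) * N%:R - k%:R) / N%:R.
  by field; rewrite lt0r_neq0.
rewrite normrM normfV (gtr0_norm N0) ler_pdivrMr// mulVf ?lt0r_neq0//.
rewrite ger0_norm ?subr_ge0// lerBlDl.
by apply: ltW; rewrite -(natrD _ k 1%N) addn1.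
Qed.

(* [x] is a [W q]-small vector which stays outside [C + V] even after
   [W q']-perturbations, [C] being the parallelepiped spanned by the [b i]:
   the step of the construction of a rigid sequence. *)
Lemma avoid_parallelepiped (R : realType) (Y : topologicalLmodType R)
    (W : nat -> set Y) (U V : set Y) (m : nat) (b : nat -> Y) (q : nat) :
  nbhs_string W -> nbhs 0 V -> balanced V ->
  (forall x1 x2 x3 x4, V x1 -> V x2 -> V x3 -> V x4 -> U (x1 + x2 + x3 + x4)) ->
  (forall n, exists2 x, W n x & exists k, forall v w, U v -> W k w -> x <> v + w) ->
  exists x q', [/\ (q <= q')%N, W q x &
    forall (s : nat -> R) v w, (forall i, (i < m)%N -> `|s i| <= 1) ->
      V v -> W q' w -> x <> \sum_(i < m) s i *: b i + v + w].
Proof.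
move=> sW V0 bV VU xU; have [_ bW Wadd] := sW.
have [l lP] := finite_net m b V0.
pose T k := [set c : Y | exists v1 v2 w, [/\ V v1, V v2, W k w & c = v1 + v2 + w]].
(* [mc c] is a rank at which [c] leaves [V + V + W k], if there is one; so belonging at rank [mc c]
   means belonging at every rank. *)
have /choice[mc mcP] : forall c : Y, exists k, T k c -> forall j, T j c.
  move=> c; case: (pselect (forall j, T j c)) => [?|/existsNP[k nk]].
    by exists 0%N.
  by exists k.
pose M := \max_(c <- l) mc c.
(* If [x] were S + v + w, with S near the net point [c], its smallness would put [c] in
   [V + V + W (mc c)], hence in [V + V + W q'], and then [x] in [U + W k]. *)
have [x Wx [k xk]] := xU (maxn q M).+1.
pose q' := (maxn k (maxn q M)).+1.
have qq' : (q <= q')%N by rewrite leqW// leq_max leq_maxl orbT.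
exists x, q'; split => //.
  by apply: nbhs_string_le Wx => //; rewrite leqW// leq_maxl.
move=> s v w s1 Vv Ww xE; have [c cl Vc] := lP _ s1.
set S := \sum_(i < m) _ in xE Vc.
have /mcP/(_ q')[v1 [v2 [w2 [Vv1 Vv2 Ww2 cE]]]] : T (mc c) c.
  exists (- v), (- (S - c)), (x - w); split.
  - exact: balancedN.
  - exact: balancedN.
  - apply: (@nbhs_string_le _ _ _ _ (maxn q M)) => //.
      by rewrite leq_max /M (leq_bigmax_seq c) ?orbT.
    apply: Wadd => //; apply: balancedN => //.
    by apply: nbhs_string_le Ww => //; rewrite ltnS leq_maxr.
  - by rewrite xE addrK opprB [S + v]addrC addrACA addNr add0r subrK.
apply: (xk (v1 + v2 + (S - c) + v) (w2 + w)).
- exact: VU.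
- apply: (@nbhs_string_le _ _ _ _ (maxn k (maxn q M))) => //.
    by rewrite leq_maxl.
  by apply: Wadd.
- by rewrite xE [RHS]addrACA [X in _ = X + _]addrAC -cE subrKC addrA.
Qed.

Lemma sum_ord_split (V : nmodType) (m n : nat) (f : nat -> V) :
  (m <= n)%N ->
  \sum_(i < n) f i = \sum_(i < m) f i + \sum_(j < n - m) f (m + j)%N.
Proof.
move=> mn; rewrite -(big_mkord xpredT f) (@big_cat_nat _ _ _ m)//= big_mkord.
congr (_ + _); rewrite -{1}[m]add0n big_addn big_mkord.
by under eq_bigr do rewrite addnC.
Qed.

Lemma sum_ord_block (V : nmodType) (N m n : nat) (f : nat -> V) :
  (N + m <= n)%N ->
  \sum_(i < n) (if (N <= i < N + m)%N then f (i - N)%N else 0) =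
  \sum_(k < m) f k.
Proof.
move=> Nmn; rewrite (sum_ord_split (fun i : nat =>
  if (N <= i < N + m)%N then f (i - N)%N else 0) (leq_trans (leq_addr m N) Nmn)).
rewrite big1 ?add0r; last by move=> i _; rewrite leqNgt ltn_ord.
rewrite (sum_ord_split (fun j => if (N <= N + j < N + m)%N
  then f (N + j - N)%N else 0) (_ : m <= n - N)%N); last first.
  by rewrite leq_subRL// (leq_trans (leq_addr m N) Nmn).
rewrite [X in _ + X]big1 ?addr0; last first.
  by move=> j _; rewrite ltn_add2l ltnNge !leq_addr.
by apply: eq_bigr => j _; rewrite leq_addr ltn_add2l ltn_ord addKn.
Qed.

Lemma le_sum1 (R : realType) (n : nat) (s : nat -> R) (i : nat) :
  (forall i, 0 <= s i) -> \sum_(i < n) s i = 1 -> (i < n)%N -> s i <= 1.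
Proof.
move=> s0 <- ilt; rewrite (bigD1 (Ordinal ilt))//= lerDl.
by apply: sumr_ge0 => j _.
Qed.

(** * Null sequences with unbounded hull, and the dense case *)

(** Block [n] consists of finitely many points of the first [n.+1] sets [V i], with a convex
    combination outside [n.+1 *: W]. The sequence enumerates all the blocks. *)
Lemma unbounded_hull_seq (R : realType) (Y : topologicalLmodType R)
    (V : nat -> set Y) (W : set Y) :
  (forall n, nbhs 0 (V n)) -> balanced W ->
  (forall U, nbhs 0 U -> ~ convex_hull U `<=` W) ->
  exists y : nat -> Y,
    (forall n, exists k0, forall k, (k0 <= k)%N -> V n (y k)) /\
    forall r : R, 0 < r -> exists2 x, convex_hull (seq_range y) x &
      ~ W (r^-1 *: x).
Proof.
move=> V0 bW nW.
pose Vc n := [set z | forall i, (i <= n)%N -> V i z].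
have Vc0 n : nbhs 0 (Vc n).
  elim: n => [|n IH].
    by apply: filterS (V0 0%N) => z Vz i; rewrite leqn0 => /eqP ->.
  apply: filterS (filterI IH (V0 n.+1)) => z [Vcz Vz] i.
  by rewrite leq_eqVlt => /orP[/eqP ->//|]; rewrite ltnS; exact: Vcz.
have /choice[B BP] : forall n, exists B : nat * (nat -> R) * (nat -> Y),
    [/\ forall i, 0 <= B.1.2 i, forall i, (i < B.1.1)%N -> Vc n (B.2 i),
      \sum_(i < B.1.1) B.1.2 i = 1 &
      ~ W (n.+1%:R^-1 *: \sum_(i < B.1.1) B.1.2 i *: B.2 i)].
  move=> n.
  have n0 : n.+1%:R != 0 :> R by rewrite pnatr_eq0.
  have : nbhs (0 : Y) [set z | Vc n (n.+1%:R *: z)].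
    by apply: nbhs_scale_preimage; rewrite scaler0.
  move=> /nW/existsNP[x /not_implyP[/convex_hull_sum[m [t [u [t0 uV t1 ->]]]] nWx]].
  exists (m, t, fun i => n.+1%:R *: u i); split => //=.
  move=> Wx; apply: nWx; move: Wx; rewrite scaler_sumr.
  by under eq_bigr do rewrite !scalerA mulrAC mulVf// mul1r.
(* Pairs (block, position) are enumerated by [pickle], shifted by one to leave index 0 free; codes
   of no point give 0. *)
pose a (p : nat * nat) := if (p.2 < (B p.1).1.1)%N then (B p.1).2 p.2 else 0.
pose y k := if k is k'.+1 then oapp a 0 (pickle_inv k') else 0.
have yE p : y (pickle p).+1 = a p by rewrite /= pickleK_inv.
exists y; split.
  move=> n; pose M := \max_(j < n) \max_(i < (B j).1.1) pickle (j : nat, i : nat).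
  (* [M] bounds the codes of the blocks before [n]; one successor makes this strict, the other
     accounts for the shift of indices. *)
  exists M.+2 => -[//|k]; rewrite ltnS => Mk /=.
  have V00 : V n 0 by exact: nbhs_singleton (V0 n).
  have := @pickle_invK (nat * nat)%type k.
  case: pickle_inv => [[j i] /= jik|//]; rewrite /a/=.
  case: ifPn => // ilt; have [nj|jn] := leqP n j.
    by have [_ /(_ _ ilt) + _ _] := BP j; exact.
  move: Mk; rewrite -jik ltnNge => /negP[]; rewrite /M.
  apply: leq_trans (leq_bigmax (Ordinal jn)).
  exact: (@leq_bigmax _ (fun i : 'I__ => pickle (j, i : nat)) (Ordinal ilt)).
move=> r r0; pose n := Num.truncn r.
have [t0 uV t1 nWx] := BP n.
exists (\sum_(i < (B n).1.1) (B n).1.2 i *: (B n).2 i).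
  apply: convex_set_sum => //; first exact: convex_hull_convex.
  move=> i ilt; apply: sub_gen_smallest; exists (pickle (n, i)).+1 => //.
  by rewrite yE /a/= ilt.
move=> Wr; apply: nWx.
set S := \sum_(i < _) _ in Wr *.
have -> : n.+1%:R^-1 *: S = (r / n.+1%:R) *: (r^-1 *: S).
  by rewrite scalerA mulrAC divff ?lt0r_neq0// mul1r.
apply: bW => //; rewrite ger0_norm; last by rewrite divr_ge0// ltW.
by rewrite ler_pdivrMr ?ltr0n// mul1r ltW// truncnS_gt.
Qed.

(** The coefficients being at most 1, the finitely many initial terms are absorbed after division by
    [r], while the tail sums into [W 2] whatever its length. *)
Lemma bounded_hull_of_tiny_tail (R : realType) (Y : topologicalLmodType R)
    (W : nat -> set Y) (k0 : nat) (y : nat -> Y) :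
  nbhs_string W -> (forall k, (k0 <= k)%N -> W k.+3 (y k)) ->
  exists2 r : R, 0 < r & forall x w, convex_hull (range y) x -> W 2%N w ->
    W 0%N (r^-1 *: (x + w)).
Proof.
move=> sW yW; have [W0 bW Wadd] := sW.
have [e e0 eW] := small_combination k0 y (W0 2%N).
pose r := Num.max 1 e^-1.
have r1 : 1 <= r by rewrite le_max lexx.
have r0 : 0 < r by exact: lt_le_trans r1.
have rV1 : `|r^-1| <= 1 by rewrite gtr0_norm ?invr_gt0// invf_le1.
have rVe : r^-1 <= e.
  by rewrite -[e]invrK lef_pV2 ?posrE ?invr_gt0// le_max lexx orbT.
exists r => // x w /convex_hull_range[n [s [s0 sn s1 ->]]] Ww.
have sle1 i : s i <= 1.
  by have [/(le_sum1 s0 s1)//|/sn ->] := ltnP i n; exact: ler01.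
rewrite -(sum_scale_widen y (leq_maxl n k0) sn).
rewrite (sum_ord_split (fun i => s i *: y i) (leq_maxr n k0)).
rewrite !scalerDr; apply: (Wadd).
  apply: (Wadd).
    rewrite scaler_sumr; under eq_bigr do rewrite scalerA.
    apply: (eW (fun i => r^-1 * s i)) => i _.
    rewrite ger0_norm; last by rewrite mulr_ge0// invr_ge0 ltW.
    by apply: le_trans rVe; rewrite ler_piMr// invr_ge0 ltW.
  apply: (bW) => //; apply: (nbhs_string_sum
    (w := fun j => s (k0 + j)%N *: y (k0 + j)%N) sW) => j _.
  apply: bW; first by rewrite ger0_norm.
  apply: nbhs_string_le (yW (k0 + j)%N (leq_addr _ _)) => //.
  by rewrite !addSn add0n !ltnS leq_addl.
by apply: bW => //; exact: nbhs_string_le Ww.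
Qed.

Definition hull_perturbation (R : realType) (Y : topologicalLmodType R)
    (A V : set Y) : Prop :=
  forall U, nbhs 0 U -> exists B,
    A `<=` set_add B U /\ ~ convex_hull A `<=` set_add (convex_hull B) V.

Lemma hull_perturbation_dense (R : realType) (Y : topologicalLmodType R)
    (W : nat -> set Y) :
  nbhs_string W -> (forall U, nbhs 0 U -> ~ convex_hull U `<=` W 0%N) ->
  (forall U, nbhs 0 U -> exists n, forall x k, W n x -> set_add U (W k) x) ->
  exists A, hull_perturbation A (W 2%N).
Proof.
move=> sW nW dW; have [W0 bW Wadd] := sW.
have [y [yW yunb]] := unbounded_hull_seq W0 (bW 0%N) nW.
exists (seq_range y) => U U0.
have [n nUW] := dW _ U0; have [k0 yn] := yW n.
(* [e k] is the error in approximating [y k] by a point of [U]; the precision [W k.+3] improves with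
   [k], so the errors form a tiny tail. *)
have /choice[e eP] : forall k, exists e : Y, (k0 <= k)%N ->
    W k.+3 e /\ exists2 v, U v & y k = v + e.
  move=> k; have [k0k|kk0] := leqP k0 k; last by exists 0.
  by have [v Uv [e We <-]] := nUW _ k.+3 (yn _ k0k); exists e => _; split=> //; exists v.
pose y' k := if (k < k0)%N then y k else e k.
exists (range y'); split.
  move=> _ [k _ <-]; have [kk0|k0k] := ltnP k k0.
    exists (y' k); first by exists k.
    by exists 0; [exact: nbhs_singleton U0|rewrite addr0 /y' kk0].
  have [_ [v Uv yE]] := eP _ k0k.
  exists (y' k); first by exists k.
  by exists v => //; rewrite /y' ltnNge k0k/= addrC.
have [|r r0 rW] := @bounded_hull_of_tiny_tail _ _ _ k0 y' sW.
  by move=> k k0k; rewrite /y' ltnNge k0k/=; have [] := eP _ k0k.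
have [x hx nWx] := yunb _ r0.
by move=> /(_ _ hx)[z hz [w Ww zwx]]; apply: nWx; rewrite -zwx; exact: rW.
Qed.

(** * Rigid sequences and the other case *)

(** Each [b n] avoids the parallelepiped of its predecessors modulo [V] and all later terms. A
    combination in [V] with a coefficient above 1, divided by its largest coefficient, would
    contradict this at the index of that coefficient. *)
Lemma rigid_seq_exists (R : realType) (Y : topologicalLmodType R)
    (W : nat -> set Y) (U : set Y) :
  nbhs_string W -> nbhs 0 U ->
  (forall n, exists2 x, W n x & exists k, ~ set_add U (W k) x) ->
  exists (b : nat -> Y) (V : set Y), [/\ nbhs 0 V, forall i, W i.+3 (b i) &
    forall n (s : nat -> R), V (\sum_(i < n) s i *: b i) ->
      forall i, (i < n)%N -> `|s i| <= 1].
Proof.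
move=> sW U0 xU; have [_ bW _] := sW.
have [U1 [U10 _ U1U]] := nbhs0_halve U0.
have [V [V0 bV VU1]] := nbhs0_halve U10.
have VU x1 x2 x3 x4 : V x1 -> V x2 -> V x3 -> V x4 -> U (x1 + x2 + x3 + x4).
  by move=> ? ? ? ?; rewrite -addrA; apply: U1U; exact: VU1.
have {}xU n : exists2 x, W n x & exists k, forall v w, U v -> W k w -> x <> v + w.
  have [x Wx [k nx]] := xU n; exists x => //; exists k => v w Uv Ww xvw.
  by apply: nx; exists v => //; exists w.
have /choice[f fP] : forall p : seq Y * nat, exists r : Y * nat,
    [/\ (p.2 <= r.2)%N, W p.2 r.1 &
    forall (s : nat -> R) v w, (forall i, (i < size p.1)%N -> `|s i| <= 1) ->
      V v -> W r.2 w -> r.1 <> \sum_(i < size p.1) s i *: p.1`_i + v + w].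
  move=> [L q].
  have [x [q' ?]] := avoid_parallelepiped (size L) (nth 0 L) q sW V0 bV VU xU.
  by exists (x, q').
(* The state holds the terms chosen so far and the rank for the next one. The rank starts at 3 and
   strictly increases, so the terms after [b l] sum into [W (q l)]. *)
pose st n := iter n (fun p : seq Y * nat =>
  (rcons p.1 (f p).1, (f p).2.+1)) ([::], 3%N).
pose b n := (f (st n)).1.
pose q n := (f (st n)).2.
have st1 n : (st n).1 = mkseq b n.
  elim: n => [//|n IH]; rewrite /st iterS -/(st n)/= IH /mkseq -[n.+1]addn1.
  by rewrite iotaD map_cat/= add0n cats1.
have st2 n : (st n.+1).2 = (q n).+1 by [].
have stq n : ((st n).2 <= q n)%N by have [] := fP (st n).
have stD m n : ((st m).2 + n <= (st (m + n)%N).2)%N.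
  elim: n => [|n IH]; first by rewrite !addn0.
  by rewrite !addnS st2 ltnS (leq_trans IH).
have bW' n : W (st n).2 (b n) by have [] := fP (st n).
exists b, V; split => //.
  move=> i; apply: nbhs_string_le (bW' i) => //.
  by have := stD 0%N i; rewrite add0n addSn addSn addSn add0n.
move=> n s Vs i0 i0n; rewrite leNgt; apply/negP => si0.
pose l := [arg max_(j > Ordinal i0n) `|s j| ]%O.
have lmax (j : nat) : (j < n)%N -> `|s j| <= `|s l|.
  move=> jn; rewrite /l; case: arg_maxP => //= i _ /(_ (Ordinal jn)).
  exact.
have sl1 : 1 < `|s l| by apply: lt_le_trans si0 (lmax _ _).
have sl0 : 0 < `|s l| by exact: lt_trans sl1.
pose g i := (s l)^-1 * s i.
have g1 (j : nat) : (j < n)%N -> `|g j| <= 1.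
  by move=> jn; rewrite normrM normfV ler_pdivrMl// mulr1 lmax.
have gl : g l = 1 by rewrite /g mulVf// -normr_gt0.
have Vg : V (\sum_(i < n) g i *: b i).
  have := bV (s l)^-1 _ _ Vs; rewrite scaler_sumr.
  under eq_bigr do rewrite scalerA.
  by apply; rewrite normfV invf_le1// ltW.
have [_ _ avoid] := fP (st l).
pose w := \sum_(j < n - l.+1) g (l.+1 + j)%N *: b (l.+1 + j)%N.
have Ww : W (q l) w.
  apply: (nbhs_string_sum
    (w := fun j => g (l.+1 + j)%N *: b (l.+1 + j)%N) sW) => j jn.
  apply: bW.
    by apply: g1; rewrite -ltn_subRL.
  by apply: nbhs_string_le (bW' _) => //; rewrite -addSn -st2 stD.
have gE : \sum_(i < n) g i *: b i = \sum_(i < l) g i *: b i + b l + w.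
  rewrite (sum_ord_split (fun i => g i *: b i) (ltn_ord l)) big_ord_recr/=.
  by rewrite gl scale1r.
apply: (avoid (fun i => - g i) (\sum_(i < n) g i *: b i) (- w)) => //.
- move=> i; rewrite st1 size_mkseq normrN => il.
  by apply: g1; exact: ltn_trans il (ltn_ord l).
- exact: balancedN.
- rewrite gE st1 size_mkseq.
  have -> : \sum_(i < l) - g i *: (mkseq b l)`_i = - \sum_(i < l) g i *: b i.
    by rewrite -sumrN; apply: eq_bigr => i _; rewrite nth_mkseq// scaleNr.
  by rewrite !addrA addNr add0r addrK.
Qed.

(* Testing against a finite net of the parallelepiped of the [u k] turns the
   rigidity of [b] into rigidity modulo that parallelepiped, far enough along
   the sequence. *)
Lemma rigid_modulo_parallelepiped (R : realType) (Y : topologicalLmodType R)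
    (V V1 V2 : set Y) (b u : nat -> Y) (m : nat) :
  (forall n (s : nat -> R), V (\sum_(i < n) s i *: b i) ->
    forall i, (i < n)%N -> `|s i| <= 1) ->
  nbhs 0 V2 -> balanced V1 ->
  (forall x y, V1 x -> V1 y -> V (x + y)) ->
  (forall x y, V2 x -> V2 y -> V1 (x + y)) ->
  exists N, forall n (x s : nat -> R),
    (forall k, (k < m)%N -> `|s k| <= 1) ->
    V2 (\sum_(i < n) x i *: b i + \sum_(k < m) s k *: u k) ->
    forall i, (N <= i < n)%N -> `|x i| <= 1.
Proof.
move=> rigid V20 bV1 V1V V2V1.
have [V3 [V30 bV3 V3V2]] := nbhs0_balanced V20.
have [l lP] := finite_net m u V30.
(* For each [c], one reference combination approximating [- c] is fixed, if any exists. Another one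
   differs from it by an element of [V], and beyond the length of the reference this difference
   keeps its coefficients. *)
have /choice[F FP] : forall c : Y, exists F : nat * (nat -> R),
    (exists n (x : nat -> R), V1 (\sum_(i < n) x i *: b i + c)) ->
    V1 (\sum_(i < F.1) F.2 i *: b i + c).
  move=> c; have [[n [x Vx]]|?] := pselect (exists n (x : nat -> R),
    V1 (\sum_(i < n) x i *: b i + c)).
    by exists (n, x).
  by exists (0%N, fun=> 0).
exists (\max_(c <- l) (F c).1) => n x s s1 Vxs i /andP[Ni iltn].
have [c cl Vc] := lP _ s1.
have Vxc : V1 (\sum_(i < n) x i *: b i + c).
  set X := \sum_(i < n) _ in Vxs *; set S := \sum_(i < m) _ in Vxs Vc.
  have -> : X + c = (X + S) + - (S - c).
    by rewrite opprB [c - S]addrC addrA addrK.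
  by apply: V2V1 => //; apply: V3V2; exact: balancedN.
have := FP c (ex_intro _ n (ex_intro _ x Vxc)).
set n' := (F c).1; set x' := (F c).2 => Vx'c.
have n'i : (n' <= i)%N by apply: leq_trans Ni; exact: leq_bigmax_seq.
pose X j := x j - (if (j < n')%N then x' j else 0).
have -> : x i = X i by rewrite /X ltnNge n'i subr0.
apply: (rigid n X) => //.
have -> : \sum_(j < n) X j *: b j =
    (\sum_(j < n) x j *: b j + c) - (\sum_(j < n') x' j *: b j + c).
  rewrite opprD addrACA subrr addr0.
  under eq_bigr do rewrite scalerBl.
  rewrite big_split/= sumrN; congr (_ - _).
  rewrite (sum_scale_widen (m := n') (s := fun j => if (j < n')%N then x' j else 0)).
  - by apply: eq_bigr => j _; rewrite ltn_ord.
  - by rewrite (leq_trans n'i)// ltnW.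
  - by move=> j; rewrite ltnNge => ->.
by apply: V1V => //; exact: balancedN.
Qed.

Lemma hull_perturbation_rigid (R : realType) (Y : topologicalLmodType R)
    (W : nat -> set Y) (V : set Y) (b : nat -> Y) :
  nbhs_string W -> (forall U, nbhs 0 U -> ~ convex_hull U `<=` W 0%N) ->
  nbhs 0 V -> (forall i, W i.+3 (b i)) ->
  (forall n (s : nat -> R), V (\sum_(i < n) s i *: b i) ->
    forall i, (i < n)%N -> `|s i| <= 1) ->
  exists A V' : set Y, nbhs 0 V' /\ hull_perturbation A V'.
Proof.
move=> sW nW V0 bW rigid; have [W0 balW Wadd] := sW.
have [V1 [V10 bV1 V1V]] := nbhs0_halve V0.
have [V2 [V20 bV2 V2V1]] := nbhs0_halve V10.
have [V3 [V30 bV3 V3s]] := nbhs0_balanced (filterI V20 (W0 2%N)).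
have V3V1 x y : V3 x -> V3 y -> V1 (x + y).
  by move=> /V3s[? _] /V3s[? _]; exact: V2V1.
(* The growing factor improves the rigidity bound to [i.+1%:R^-1] for coefficients with respect to
   [c]. *)
pose c i := i.+1%:R *: b i.
exists (range c), V3; split => // U' /nbhs0_balanced[U [U0 bU UU']].
have : exists x, convex_hull U x /\ ~ W 0%N x.
  by have /existsNP[x /not_implyP] := nW _ U0; exists x.
move=> [_ [/convex_hull_sum[m [t [u [t0 uU t1 ->]]]] nWz]].
have [N1 N1P] := rigid_modulo_parallelepiped (V := V) (b := b) u m rigid V30 bV1 V1V V3V1.
have [e1 e10 e1P] := small_combination m u (W0 2%N).
have [e2 e20 e2P] := small_combination N1 c (W0 2%N).
pose e := Num.min e1 e2.
have e0 : 0 < e by rewrite lt_min e10.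
(* Past [N1] rigidity holds modulo the [u k]; the second bound makes both [1 / N.+1%:R] and
   [m%:R / N.+1%:R] at most [e]. *)
pose N := maxn N1 (Num.truncn (m.+1%:R / e)).
have N1N : (N1 <= N)%N by rewrite leq_maxl.
have N0 : 0 < N.+1%:R :> R by rewrite ltr0n.
have mN : m.+1%:R / N.+1%:R <= e.
  rewrite ler_pdivrMr// mulrC -ler_pdivrMr//.
  apply: le_trans (ltW (truncnS_gt _)) _.
  by rewrite ler_nat ltnS leq_maxr.
have mle k : (k <= m.+1)%N -> k%:R / N.+1%:R <= e.
  by move=> km; apply: le_trans mN; rewrite ler_pM2r ?invr_gt0// ler_nat.
pose v i := if (N <= i < N + m)%N then u (i - N)%N else 0.
exists (range (fun i => c i + v i)); split.
  move=> _ [i _ <-]; exists (c i + v i); first by exists i.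
  exists (- v i); last by rewrite addrK.
  apply: UU'; apply: balancedN => //; rewrite /v.
  case: ifPn => [/andP[Ni iN]|_]; last exact: nbhs_singleton.
  by apply: uU; rewrite ltn_subLR.
pose p := \sum_(k < m) t k *: c (N + k)%N.
have hp : convex_hull (range c) p.
  apply: (convex_set_sum (y := fun k => c (N + k)%N)) => //.
    exact: convex_hull_convex.
  by move=> k _; apply: sub_gen_smallest; exists (N + k)%N.
move=> /(_ _ hp)[_ /convex_hull_range[n0 [s [s0 sn s1 ->]]] [w Vw swp]].
pose n := maxn n0 (N + m).
have n0n : (n0 <= n)%N by rewrite leq_maxl.
have Nmn : (N + m <= n)%N by rewrite leq_maxr.
rewrite -(sum_scale_widen (fun i => c i + v i) n0n sn) in swp.
rewrite -(sum_widen n0n sn) in s1.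
pose t' i := if (N <= i < N + m)%N then t (i - N)%N else 0.
(* The coefficients of an approximation from the new hull minus those of [p]. *)
pose x i := s i - t' i.
have pE : p = \sum_(i < n) t' i *: c i.
  rewrite /p -(sum_ord_block (fun k => t k *: c (N + k)%N) Nmn).
  apply: eq_bigr => i _; rewrite /t'; case: ifPn => [/andP[Ni _]|_].
    by rewrite subnKC.
  by rewrite scale0r.
have vE : \sum_(i < n) s i *: v i = \sum_(k < m) s (N + k)%N *: u k.
  rewrite -(sum_ord_block (fun k => s (N + k)%N *: u k) Nmn).
  apply: eq_bigr => i _; rewrite /v; case: ifPn => [/andP[Ni _]|_].
    by rewrite subnKC.
  by rewrite scaler0.
have xE : \sum_(i < n) x i *: c i + \sum_(k < m) s (N + k)%N *: u k = - w.
  move: swp; rewrite pE -vE.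
  under eq_bigr do rewrite scalerDr.
  under [X in _ -> X + _ = _]eq_bigr do rewrite scalerBl.
  rewrite !big_split/= sumrN => <-.
  by rewrite addrAC opprD addrA subrr add0r.
have s_le1 i : s i <= 1.
  by have [/(le_sum1 s0 s1)//|ni] := ltnP i n; rewrite sn ?ler01// (leq_trans n0n).
have x_small i : (N1 <= i < n)%N -> `|x i * i.+1%:R| <= 1.
  apply: (N1P n (fun i => x i * i.+1%:R) (fun k => s (N + k)%N)).
    by move=> k _; rewrite ger0_norm.
  under eq_bigr do rewrite -scalerA.
  by rewrite xE; exact: balancedN.
have ts k : (k < m)%N -> `|t k - s (N + k)%N| <= 1 / N.+1%:R.
  move=> km.
  have := x_small (N + k)%N; rewrite (leq_trans N1N (leq_addr _ _))/=.
  have Nkn : (N + k < n)%N by rewrite (leq_trans _ Nmn)// ltn_add2l.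
  move=> /(_ Nkn); rewrite /x /t' leq_addr ltn_add2l km/= addKn normrM distrC.
  rewrite [X in _ * X]ger0_norm// => H; rewrite ler_pdivlMr//.
  by apply: le_trans H; rewrite ler_wpM2l// ler_nat ltnS leq_addr.
(* The total mass is 1 and, by [ts], the block from [N] carries all of it but at most
   [m%:R / N.+1%:R], which bounds each earlier coefficient. *)
have s_init i : (i < N1)%N -> s i <= m%:R / N.+1%:R.
  move=> iN1; have iN : (i < N)%N := leq_trans iN1 N1N.
  have : s i + \sum_(k < m) s (N + k)%N <= 1.
    rewrite -s1 -(sum_ord_block (fun k => s (N + k)%N) Nmn).
    have iin : (i + 1 <= n)%N.
      by rewrite addn1 (leq_trans _ Nmn)// ltn_addr.
    have := sum_ord_block (fun=> s i) iin; rewrite big_ord1 => <-.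
    rewrite -big_split/=; apply: ler_sum => j _.
    have [/andP[ij ji]|_] := boolP (i <= j < i + 1)%N.
      have -> : nat_of_ord j = i.
        by move: ji; rewrite addn1 ltnS => ji; apply/eqP; rewrite eqn_leq ij ji.
      by rewrite leqNgt iN/= addr0.
    by rewrite add0r; case: ifPn => [/andP[Nj _]|//]; rewrite subnKC.
  rewrite -lerBrDr => /le_trans; apply; rewrite -[X in X - _ <= _]t1 -sumrB.
  apply: (@le_trans _ _ (\sum_(k < m) (1 / N.+1%:R))).
    by apply: ler_sum => k _; apply: le_trans (ts _ (ltn_ord k)); exact: ler_norm.
  by rewrite sumr_const card_ord div1r mulr_natl.
apply: nWz.
(* Four pieces, each in [W 2]: the coefficient errors on the block, [w], the terms before [N1], and
   the tail, small because the [b i] are. *)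
have -> : \sum_(k < m) t k *: u k =
    (\sum_(k < m) (t k - s (N + k)%N) *: u k - w) - \sum_(i < n) x i *: c i.
  rewrite -xE; under [in RHS]eq_bigr do rewrite scalerBl.
  rewrite big_split/= sumrN.
  by rewrite addrACA addNr addr0 addrK.
have N1n : (N1 <= n)%N by rewrite (leq_trans N1N)// (leq_trans (leq_addr m N)).
rewrite (sum_ord_split (fun i => x i *: c i) N1n) opprD.
apply: (Wadd); apply: (Wadd).
- apply: (e1P (fun k => t k - s (N + k)%N)) => k km.
  apply: le_trans (ts _ km) _.
  by apply: le_trans (mle 1%N _) _ => //; rewrite ge_min lexx.
- by apply: balancedN => //; have [] := V3s _ Vw.
- apply: balancedN => //; apply: e2P => i iN1.
  rewrite /x /t' leqNgt (leq_trans iN1 N1N)/= subr0 ger0_norm//.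
  apply: le_trans (s_init _ iN1) _.
  by apply: le_trans (mle m _) _ => //; rewrite ge_min lexx orbT.
- apply: balancedN => //.
  apply: (nbhs_string_sum (w := fun j => x (N1 + j)%N *: c (N1 + j)%N) sW) => j jn.
  rewrite /c scalerA; apply: (balW).
    by apply: x_small; rewrite leq_addr/= -ltn_subRL.
  by apply: nbhs_string_le (bW _) => //; rewrite !addSn add0n !ltnS leq_addl.
Qed.

(** * A multifunction on the space of germs *)

(* The index space of the counterexample: its points are the sets of [Y], and
   the neighbourhoods of [set0] are generated by the families of all subsets of
   a neighbourhood of 0, so that a net indexed by these neighbourhoods
   converges to [set0]. *)
Definition set_germs (R : realType) (Y : topologicalLmodType R) : Type := set Y.

HB.instance Definition _ (R : realType) (Y : topologicalLmodType R) :=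
  Choice.on (set_germs Y).

(** Families missing [set0] are all open: every other point is isolated. *)
Definition set_germs_open (R : realType) (Y : topologicalLmodType R) :
    set_system (set_germs Y) :=
  [set P | P set0 -> exists2 U : set Y, nbhs 0 U & forall U', U' `<=` U -> P U'].

Lemma set_germs_openT (R : realType) (Y : topologicalLmodType R) :
  set_germs_open [set: set_germs Y].
Proof. by move=> _; exists setT => //; exact: filterT. Qed.

Lemma set_germs_openI (R : realType) (Y : topologicalLmodType R) :
  setI_closed (@set_germs_open R Y).
Proof.
move=> P Q oP oQ [/oP[U U0 UP] /oQ[V V0 VQ]].
exists (U `&` V); first exact: filterI.
by move=> U'; rewrite subsetI => -[? ?]; split; [exact: UP|exact: VQ].
Qed.

Lemma set_germs_open_bigU (R : realType) (Y : topologicalLmodType R)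
    (I : Type) (f : I -> set (set_germs Y)) :
  (forall i, set_germs_open (f i)) -> set_germs_open (\bigcup_i f i).
Proof.
move=> of_ [i _ /of_[U U0 Uf]]; exists U => // U' /Uf ?.
by exists i.
Qed.

HB.instance Definition _ (R : realType) (Y : topologicalLmodType R) :=
  isOpenTopological.Build (set_germs Y) (@set_germs_openT R Y)
    (@set_germs_openI R Y) (@set_germs_open_bigU R Y).

Lemma nbhs_set_germs (R : realType) (Y : topologicalLmodType R)
    (P : set (set_germs Y)) :
  nbhs (set0 : set_germs Y) P <->
  exists2 U : set Y, nbhs 0 U & forall U', U' `<=` U -> P U'.
Proof.
split=> [[Q [oQ Q0 QP]]|[U U0 UP]].
  by have [U U0 UQ] := oQ Q0; exists U => // U' /UQ; exact: QP.
exists [set U' : set Y | U' `<=` U]; split => //.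
by move=> _; exists U.
Qed.

Lemma hull_perturbation_Hlsc (R : realType) (Y : topologicalLmodType R)
    (A V : set Y) :
  nbhs 0 V -> hull_perturbation A V ->
  exists (X : topologicalType) (F : X -> set Y) (x0 : X),
    Hlsc_at F x0 /\ ~ Hlsc_at (convex_hull_mf F) x0.
Proof.
move=> V0 hA.
have /choice[g gP] : forall U : set Y, exists B, nbhs 0 U ->
    A `<=` set_add B U /\ ~ convex_hull A `<=` set_add (convex_hull B) V.
  by move=> U; have [/hA[B ?]|?] := pselect (nbhs 0 U); [exists B|exists A].
(* The default value [A] is taken at the base point too, since [set0] does not contain 0. *)
pose F (U : set_germs Y) : set Y := if `[< nbhs (0 : Y) U >] then g U else A.
have F0 : F set0 = A.
  by rewrite /F asboolF// => /nbhs_singleton.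
exists (set_germs Y), F, set0; split.
  move=> U U0; exists [set U' : set Y | U' `<=` U].
    by apply/nbhs_set_germs; exists U.
  move=> U' U'U a; rewrite F0 => Aa; rewrite /F; case: asboolP => U'0.
    have [/(_ _ Aa)[b gb [u U'u <-]] _] := gP _ U'0.
    by exists b => //; exists u => //; exact: U'U.
  by exists a => //; exists 0; rewrite ?addr0//; exact: nbhs_singleton U0.
move=> /(_ _ V0)[P /nbhs_set_germs[U U0 UP] PF].
have [_ nA] := gP _ U0; apply: nA.
have := PF _ (UP _ (@subset_refl _ U)).
by rewrite /convex_hull_mf F0 /F asboolT.
Qed.

(** * The multifunction of a null sequence *)

Lemma nbhs_inv_nat0 (R : realType) (U : set (inv_nat_set R)) :
  nbhs (inv_nat0 R) U <->
  exists2 e : R, 0 < e & forall x : inv_nat_set R, `|set_val x| < e -> U x.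
Proof.
split=> [[_ [[D oD <-] D0 DU]]|[e e0 eU]].
  have : nbhs (0 : R) D by apply: open_nbhs_nbhs; split.
  case/nbhs_ballP => e /= e0 eD; exists e => // x xe; apply: DU => /=.
  by apply: eD; rewrite /ball/= sub0r normrN.
have : nbhs (set_val (inv_nat0 R)) (ball (0 : R) e) by exact: nbhsx_ballx.
move=> /(@initial_continuous _ _ set_val (inv_nat0 R)).
apply: (@filterS _ (nbhs (inv_nat0 R))) => x /=.
by rewrite /ball/= sub0r normrN => /eU.
Qed.

(** A term of F(0) missing from F(1/n) has index above n, so near 0 it lies in [V] and is
    approximated by the point 0 of F(1/n). *)
Lemma Hlsc_seq_mf (R : realType) (Y : topologicalLmodType R) (y : nat -> Y) :
  y n @[n --> \oo] --> (0 : Y) -> Hlsc_at (@seq_mf R Y y) (inv_nat0 R).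
Proof.
move=> y0 V V0; have Vz := nbhs_singleton V0.
have [N _ NV] := y0 _ V0.
exists [set x | `|set_val x| < N.+1%:R^-1].
  by apply/nbhs_inv_nat0; exists N.+1%:R^-1 => //; rewrite invr_gt0 ltr0n.
have in_mf (x : inv_nat_set R) : seq_mf y x 0.
  have [|[n n0 nx]] := set_mem (valP x); first by left; split => //; left.
  by right; exists n; split => //; left.
move=> x /= xN z; rewrite seq_mf0 => -[->|[k k0 <-]].
  by exists 0; [exact: in_mf|exists 0; rewrite ?addr0].
have [xk|nxk] := pselect (seq_mf y x (y k)).
  by exists (y k) => //; exists 0; rewrite ?addr0.
exists 0; first exact: in_mf.
exists (y k); last by rewrite add0r.
apply: NV => /=; rewrite leqNgt; apply/negP => kN; apply: nxk.
have [x0|[n n0 nx]] := set_mem (valP x).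
  by left; split => //; right; exists k.
right; exists n; split => //; right; exists k => //.
rewrite k0/= leqNgt; apply/negP => nk.
move: xN; rewrite set_valE -nx ger0_norm// ltf_pV2 ?posrE ?ltr0n//.
by rewrite ltr_nat ltnNge leqW// ltnW// (ltn_trans nk).
Qed.

(** Lower semicontinuity would put the whole hull within [W 2] of the hull of a finite set, which is
    bounded. *)
Lemma not_Hlsc_hull_seq_mf (R : realType) (Y : topologicalLmodType R)
    (y : nat -> Y) :
  ~ tvs_bounded (convex_hull (seq_range y)) ->
  ~ Hlsc_at (convex_hull_mf (@seq_mf R Y y)) (inv_nat0 R).
Proof.
move=> nb lsc; apply: nb => V0 /nbhs_string_exists[W sW WV0].
have [W0 bW Wadd] := sW.
have [U /nbhs_inv_nat0[e e0 eU] UF] := lsc _ (W0 2%N).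
pose n := (Num.truncn e^-1).+1.
have n0 : (0 < n)%N by [].
have /UF : U (inv_natV R n0).
  apply: eU; rewrite set_valE/= ger0_norm// -[e]invrK.
  by rewrite ltf_pV2 ?posrE ?invr_gt0// truncnS_gt.
rewrite /convex_hull_mf seq_mf0 seq_mfV => hF.
(* The finite set F(1/n) as a sequence with zero tail; index 0 supplies the point 0. *)
pose y' k := if (0 < k <= n)%N then y k else 0.
have [|r r0 rW] := @bounded_hull_of_tiny_tail _ _ _ n.+1 y' sW.
  by move=> k nk; rewrite /y' [(k <= n)%N]leqNgt nk andbF; exact: nbhs_string0.
exists r => // t rt x hx.
have t0 : 0 < `|t| by exact: lt_le_trans rt.
have /hF[z hz [w Ww zwx]] : convex_hull ([set 0] `|` seq_range y) x.
  by apply: sub_smallest2r hx => //; exact: convex_hull_convex.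
have hz' : convex_hull (range y') z.
  apply: sub_smallest2r hz => //; first exact: convex_hull_convex.
  move=> _ [->|[k kn <-]]; first by exists 0%N.
  by exists k => //; rewrite /y' kn.
exists (t^-1 *: x); last first.
  by rewrite scalerA divff ?scale1r// -normr_gt0.
apply: WV0; have := rW _ _ hz' Ww; rewrite zwx => /(bW 0%N (r / t)).
rewrite scalerA mulrAC divff ?lt0r_neq0// mul1r; apply.
by rewrite normrM normfV (gtr0_norm r0) ler_pdivrMr// mul1r.
Qed.

(** * The metrizable case, the dichotomy and the conclusion *)

Lemma null_seq_unbounded_hull (R : realType) (Y : topologicalLmodType R) :
  ~ is_locally_convex Y -> metrizable R Y ->
  exists y : nat -> Y,
    y n @[n --> \oo] --> (0 : Y) /\ ~ tvs_bounded (convex_hull (seq_range y)).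
Proof.
move=> /not_locally_convex_hull[W1 W10 W1P] [d [_ _ _ dnbhs]].
have [W [W0 bW WW1]] := nbhs0_balanced W10.
have [|//|U U0 hU|y [yV yunb]] := @unbounded_hull_seq _ _
    (fun n => [set z : Y | d 0 z < n.+1%:R^-1]) W.
- by move=> n; apply/dnbhs; exists n.+1%:R^-1; rewrite ?invr_gt0.
- by apply: (W1P _ U0); exact: subset_trans WW1.
exists y; split.
  move=> U /dnbhs[e e0 eU].
  have [k0 k0y] := yV (Num.truncn e^-1).
  exists k0 => // k /= /k0y /= dk; apply: eU => /=; apply: lt_trans dk _.
  by rewrite -[ltRHS]invrK ltf_pV2 ?posrE ?invr_gt0// truncnS_gt.
move=> /(_ _ W0)[r r0 rW]; have [x hx nWx] := yunb _ r0.
have [|v Wv vx] := rW r _ _ hx; first by rewrite ger0_norm// ltW.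
by apply: nWx; rewrite -vx scalerA mulVf ?lt0r_neq0// scale1r.
Qed.

Lemma not_locally_convex_hull_perturbation (R : realType)
    (Y : topologicalLmodType R) :
  ~ is_locally_convex Y ->
  exists A V : set Y, nbhs 0 V /\ hull_perturbation A V.
Proof.
move=> /not_locally_convex_hull[W1 W10 W1P].
have [W sW WW1] := nbhs_string_exists W10.
have nW U : nbhs 0 U -> ~ convex_hull U `<=` W 0%N.
  by move=> /W1P + UW; apply; exact: subset_trans WW1.
have [dense|] := pselect (forall U : set Y, nbhs 0 U ->
    exists n, forall x k, W n x -> set_add U (W k) x).
  have [A hA] := hull_perturbation_dense sW nW dense.
  by exists A, (W 2%N); split => //; have [] := sW.
move=> /existsNP[U /not_implyP[U0 /forallNP nUW]].
have [|b [V [V0 bW rigid]]] := rigid_seq_exists sW U0.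
  move=> n; have /existsNP[x /existsNP[k /not_implyP[Wx nx]]] := nUW n.
  by exists x => //; exists k.
exact: hull_perturbation_rigid sW nW V0 bW rigid.
Qed.

Theorem mainTheorem9 (R : realType) (Y : topologicalLmodType R) :
  ~ is_locally_convex Y ->
  (exists (X : topologicalType) (F : X -> set Y) (x0 : X),
      Hlsc_at F x0 /\ ~ Hlsc_at (convex_hull_mf F) x0) /\
  (metrizable R Y ->
    (exists y : nat -> Y,
        y n @[n --> \oo] --> (0 : Y) /\ ~ tvs_bounded (convex_hull (seq_range y))) /\
    (forall y : nat -> Y,
        y n @[n --> \oo] --> (0 : Y) -> ~ tvs_bounded (convex_hull (seq_range y)) ->
        Hlsc_at (@seq_mf R Y y) (inv_nat0 R) /\
        ~ Hlsc_at (convex_hull_mf (@seq_mf R Y y)) (inv_nat0 R))).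
Proof.
move=> nlc; split.
  have [A [V [V0 hA]]] := not_locally_convex_hull_perturbation nlc.
  exact: hull_perturbation_Hlsc V0 hA.
move=> mY; split; first exact: null_seq_unbounded_hull.
by move=> y y0 yb; split; [exact: Hlsc_seq_mf|exact: not_Hlsc_hull_seq_mf].
Qed.
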